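(* Let $\overline{x}_1,\overline{x}_2,\overline{x}_3,\overline{x}_4\in\mathbb{R}^3$ be four vectors no three of which are coplanar. Consider the signs of the four determinants $$\det(\overline{x}_1,\overline{x}_2,\overline{x}_3),\quad \det(\overline{x}_1,\overline{x}_4,\overline{x}_2),\quad \det(\overline{x}_3,\overline{x}_2,\overline{x}_4),\quad \det(\overline{x}_1,\overline{x}_3,\overline{x}_4).$$ A supporting plane for $\overline{x}_1,\dots,\overline{x}_4$ does not exist if and only if all four signs are the same.
   Context: All planes are linear subspaces, i.e. they contain the origin. Vectors in $\mathbb{R}^3$ are coplanar if they lie in a common 2-dimensional linear subspace of $\mathbb{R}^3$. A supporting plane for vectors $\overline{x}_1,\dots,\overline{x}_4\in\mathbb{R}^3$ is a 2-dimensional linear subspace $P\subset\mathbb{R}^3$ such that all four vectors lie in the same open halfspace with respect to $P$; equivalently, there is a linear function $f:\mathbb{R}^3\to\mathbb{R}$ with $f(\overline{x}_i)>0$ for all $1\le i\le 4$. Vectors are viewed as column vectors, and $\det(\overline{a},\overline{b},\overline{c})$ denotes the determinant of the $3\times 3$ matrix with columns $\overline{a},\overline{b},\overline{c}$ in this order. *)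

(* Defs.v *)
From HB Require Import structures.
From mathcomp Require Import all_boot all_order all_algebra.
From mathcomp Require Import reals.

Set Implicit Arguments.
Unset Strict Implicit.
Unset Printing Implicit Defensive.

Import Order.TTheory GRing.Theory Num.Theory.
Local Open Scope ring_scope.

Definition coplanar (R : realType) (s : seq 'cV[R]_3) : Prop :=
  exists P : {vspace 'cV[R]_3}, \dim P = 2 /\ {subset s <= P}.

(* The two open halfspaces of a plane P are the sets where f > 0, for f a
   linear form with kernel P; replacing f by - f exchanges them. *)
Definition supporting_plane (R : realType) (s : seq 'cV[R]_3)
    (P : {vspace 'cV[R]_3}) : Prop :=
  \dim P = 2 /\
  exists f : 'Hom('cV[R]_3, R^o),
    lker f = P /\ forall v, v \in s -> 0 < (f v : R).

Definition det3 (R : realType) (a b c : 'cV[R]_3) : R :=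
  \det (row_mx a (row_mx b c) : 'M[R]_3).

(* Main.v *)
Require Import Defs.
From HB Require Import structures.
From mathcomp Require Import all_boot all_order all_algebra.
From mathcomp Require Import reals.
From mathcomp Require Import ring lra.

Set Implicit Arguments.
Unset Strict Implicit.
Unset Printing Implicit Defensive.

Import Order.TTheory GRing.Theory Num.Theory.
Local Open Scope ring_scope.

(** Four vectors of a 3-dimensional space satisfy a linear relation whose
    coefficients are, up to sign, the 3 x 3 determinants of the triples
    (Cramer's rule, [det3_relation]):

      det(x3,x2,x4) x1 + det(x1,x3,x4) x2 + det(x1,x4,x2) x3
        + det(x1,x2,x3) x4 = 0.

    The orderings of the columns in the theorem are the ones that make every
    sign in this relation a plus, and the coefficients are nonzero because no
    three of the vectors are coplanar.  A linear form f turns the relation into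
    a relation with the same coefficients between the values f(xi).

    If the coefficients have the same sign, the f(xi) cannot all be positive,
    so there is no supporting plane ([same_sign_no_positive_solution]).
    If two coefficients have opposite signs, the relation has a solution in
    positive reals t1, ..., t4 ([mixed_sign_positive_solution]).  Since
    x1, x2, x3 form a basis, some linear form takes the values t1, t2, t3 on
    them, and the relation forces the value t4 on x4; the kernel of this form
    is a supporting plane. *)

(** * Signs of the coefficients of a linear relation *)

Section Signs.
Variables (R : realFieldType) (I : finType).
Implicit Types c t : I -> R.

Lemma mixed_or_same_sign c : (forall i, c i != 0) ->
  (exists i j, c i < 0 < c j) \/ (forall i j, Num.sg (c i) = Num.sg (c j)).
Proof.
move=> c_neq0.
have [/existsP[i ci_lt0]|/existsPn c_ge0] := boolP [exists i, c i < 0]; last first.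
  right=> i j; rewrite !gtr0_sg // lt0r c_neq0 /= leNgt; exact: c_ge0.
have [/existsP[j cj_gt0]|/existsPn c_le0] := boolP [exists j, 0 < c j].
  by left; exists i, j; rewrite ci_lt0.
right=> k l; rewrite !ltr0_sg // lt_neqAle c_neq0 /= leNgt; exact: c_le0.
Qed.

(** Start from the all-one vector, for which the sum is S, and increase the one
    entry whose coefficient has the sign opposite to S until the sum vanishes. *)
Lemma mixed_sign_positive_solution c i j : c i < 0 -> 0 < c j ->
  exists2 t, (forall k, 0 < t k) & \sum_k c k * t k = 0.
Proof.
move=> ci_lt0 cj_gt0; set S := \sum_k c k.
have bump k : c k != 0 -> S / c k <= 0 ->
    exists2 t, (forall k, 0 < t k) & \sum_k c k * t k = 0.
  move=> ck_neq0 Sk_le0; exists (fun l => 1 - (l == k)%:R * (S / c k)).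
    by move=> l; rewrite subr_gt0; case: (l == k); rewrite ?mul1r ?mul0r //; lra.
  under eq_bigr do rewrite mulrBr mulr1.
  rewrite sumrB -/S (bigD1 k) //= eqxx mul1r big1 => [|l /negbTE->]; last first.
    by rewrite mul0r mulr0.
  by rewrite addr0 mulrCA divff // mulr1 subrr.
have [S_ge0|S_lt0] := leP 0 S.
  by apply: (bump i); rewrite ?lt_eqF // mulr_ge0_le0 // invr_le0 ltW.
by apply: (bump j); rewrite ?gt_eqF // mulr_le0_ge0 ?invr_ge0 // ltW.
Qed.

(** Up to their common sign, the coefficients are their absolute values, and the
    sum becomes a sum of positive terms. *)
Lemma same_sign_no_positive_solution c t i0 :
    (forall i, c i != 0) -> (forall i, Num.sg (c i) = Num.sg (c i0)) ->
  (forall i, 0 < t i) -> \sum_i c i * t i != 0.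
Proof.
move=> c_neq0 same_sign t_gt0.
have -> : \sum_i c i * t i = Num.sg (c i0) * \sum_i `|c i| * t i.
  rewrite mulr_sumr; apply: eq_bigr => i _.
  by rewrite mulrA -(same_sign i) -numEsg.
rewrite mulf_neq0 ?sgr_eq0 // psumr_neq0 => [|i _]; last first.
  by rewrite mulr_ge0 // ltW.
by apply/hasP; exists i0; rewrite ?mem_index_enum // mulr_gt0 ?normr_gt0.
Qed.

End Signs.

(** * Linear forms and planes in dimension 3 *)

Lemma dim_lker_form (F : fieldType) (V : vectType F) (f : 'Hom(V, F^o)) v :
  f v != 0 -> \dim (lker f) = (\dim {: V}).-1.
Proof.
move=> fv_neq0; rewrite -(limg_ker_dim f fullv) capfv.
suff -> : \dim (limg f) = 1%N by rewrite addn1.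
apply/eqP; rewrite eqn_leq; apply/andP; split.
  by apply: leq_trans (dimvS (subvf _)) _; rewrite dimvf.
rewrite lt0n dimv_eq0; apply: contra fv_neq0 => /eqP im0.
by rewrite -memv0 -im0 memv_img ?memvf.
Qed.

Section RowForm.
Variables (F : fieldType) (n : nat) (u : 'rV[F]_n).

Definition row_form_fun (v : 'cV[F]_n) : F^o := (u *m v) 0 0.

Fact row_form_fun_is_linear : linear row_form_fun.
Proof. by move=> a v w; rewrite /row_form_fun linearP !mxE. Qed.

HB.instance Definition _ :=
  GRing.isLinear.Build F 'cV[F]_n F^o *:%R row_form_fun row_form_fun_is_linear.

Definition row_form : 'Hom('cV[F]_n, F^o) := linfun row_form_fun.

Lemma row_formE v : row_form v = (u *m v) 0 0.
Proof. by rewrite lfunE. Qed.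

End RowForm.

Lemma det_mx33 (K : comNzRingType) (M : 'M[K]_3) :
  \det M = M 0 0 * (M 1 1 * M 2 2 - M 1 2 * M 2 1)
          - M 0 1 * (M 1 0 * M 2 2 - M 1 2 * M 2 0)
          + M 0 2 * (M 1 0 * M 2 1 - M 1 1 * M 2 0).
Proof.
(* Indexing by naturals lets the minors' row and column shifts compute. *)
pose m (i j : nat) := M (inord i) (inord j).
have ME i j : M i j = m i j by rewrite /m !inord_val.
do 2!rewrite !(expand_det_row _ 0) !big_ord_recl !big_ord0 /cofactor.
rewrite !det_mx11 !mxE !ME /= /bump /=; ring.
Qed.

Section Planes.
Variable R : realType.
Implicit Types (a b c x : 'cV[R]_3) (s : seq 'cV[R]_3).

Lemma coplanar_subset s s' : {subset s <= s'} -> coplanar s' -> coplanar s.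
Proof.
by move=> ss' [P [dimP s'P]]; exists P; split=> // x /ss'; apply: s'P.
Qed.

Lemma dim_lker_form3 (f : 'Hom('cV[R]_3, R^o)) x :
  f x != 0 -> \dim (lker f) = 2.
Proof. by move=> /dim_lker_form ->; rewrite dimvf. Qed.

Lemma positive_form_supporting_plane (f : 'Hom('cV[R]_3, R^o)) x s :
    (forall v, v \in x :: s -> 0 < (f v : R)) ->
  supporting_plane (x :: s) (lker f).
Proof.
move=> f_gt0; split; last by exists f.
by apply: (@dim_lker_form3 f x); rewrite gt_eqF // f_gt0 ?mem_head.
Qed.

(** The matrix is singular, so a nonzero row annihilates its columns; the
    kernel of the associated form is a plane containing them. *)
Lemma det3_eq0_coplanar a b c : det3 a b c = 0 -> coplanar [:: a; b; c].
Proof.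
rewrite /det3 => /eqP/det0P[u u_neq0].
rewrite (mul_mx_row u a) (mul_mx_row u b) => uM0.
have [ua0 ubc0] : u *m a = 0 /\ row_mx (u *m b) (u *m c) = 0.
  by apply: eq_row_mx; rewrite row_mx0.
have [ub0 uc0] : u *m b = 0 /\ u *m c = 0.
  by apply: eq_row_mx; rewrite row_mx0.
have [j uj_neq0] : exists j, u 0 j != 0.
  by apply/existsP; apply: contra_neqT u_neq0 => /existsPn u0; apply/rowP => j;
     rewrite mxE; apply/eqP; move: (u0 j); rewrite negbK.
exists (lker (row_form u)); split.
  apply: (@dim_lker_form3 _ (delta_mx j 0)).
  by rewrite row_formE -colE mxE.
by move=> v; rewrite !inE memv_ker row_formE => /or3P[]/eqP->;
   rewrite ?ua0 ?ub0 ?uc0 mxE.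
Qed.

Lemma det3E a b c :
  det3 a b c = a 0 0 * (b 1 0 * c 2 0 - c 1 0 * b 2 0)
             - b 0 0 * (a 1 0 * c 2 0 - c 1 0 * a 2 0)
             + c 0 0 * (a 1 0 * b 2 0 - b 1 0 * a 2 0).
Proof.
pose M : 'M[R]_3 := row_mx a (row_mx b c).
have Ma i : M i 0 = a i 0.
  have -> : 0 = lshift (1 + 1) 0 :> 'I_(1 + (1 + 1)) by exact: val_inj.
  exact: row_mxEl.
have Mb i : M i 1 = b i 0.
  have -> : 1 = rshift 1 (lshift 1 0) :> 'I_(1 + (1 + 1)) by exact: val_inj.
  exact: etrans (row_mxEr _ _ _ _) (row_mxEl _ _ _ _).
have Mc i : M i 2 = c i 0.
  have -> : 2 = rshift 1 (rshift 1 0) :> 'I_(1 + (1 + 1)) by exact: val_inj.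
  exact: etrans (row_mxEr _ _ _ _) (row_mxEr _ _ _ _).
by rewrite /det3 -/M det_mx33 !Ma !Mb !Mc.
Qed.

(** Put the four vectors as columns of a 3 x 4 matrix and repeat its row i on
    top: the vanishing 4 x 4 determinant, expanded along its first row, is up to
    sign the coordinate i of this vector. *)
Lemma det3_relation x1 x2 x3 x4 :
  det3 x3 x2 x4 *: x1 + det3 x1 x3 x4 *: x2 + det3 x1 x4 x2 *: x3
    + det3 x1 x2 x3 *: x4 = 0.
Proof.
apply/colP => i; rewrite !mxE !det3E.
have: [|| i == 0, i == 1 | i == 2] by case: i => [[|[|[]]]].
by case/or3P=> /eqP->; ring.
Qed.

(** The three columns form an invertible matrix M, and the row (r1, r2, r3) M^-1
    represents the form. *)
Lemma form_with_values a b c (r1 r2 r3 : R) : det3 a b c != 0 ->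
  exists f : 'Hom('cV[R]_3, R^o), [/\ f a = r1, f b = r2 & f c = r3].
Proof.
move=> det_neq0.
pose M : 'M[R]_3 := row_mx a (row_mx b c).
pose r : 'rV[R]_3 := row_mx r1%:M (row_mx r2%:M r3%:M).
have M_unit : M \in unitmx by rewrite unitmxE unitfE.
have : r *m invmx M *m M = r by rewrite mulmxKV.
set u := r *m invmx M; rewrite (mul_mx_row u a) (mul_mx_row u b) => uM.
have [ua ubc] : u *m a = r1%:M
    /\ row_mx (u *m b) (u *m c) = row_mx r2%:M r3%:M by exact: eq_row_mx.
have [ub uc] := eq_row_mx ubc.
by exists (row_form u); rewrite !row_formE ua ub uc !mxE.
Qed.

End Planes.

Theorem theorem4 (R : realType) (x1 x2 x3 x4 : 'cV[R]_3)
    (h123 : ~ coplanar [:: x1; x2; x3])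
    (h124 : ~ coplanar [:: x1; x2; x4])
    (h134 : ~ coplanar [:: x1; x3; x4])
    (h234 : ~ coplanar [:: x2; x3; x4]) :
  ~ (exists P : {vspace 'cV[R]_3}, supporting_plane [:: x1; x2; x3; x4] P)
  <->
  [/\ Num.sg (det3 x1 x2 x3) = Num.sg (det3 x1 x4 x2),
      Num.sg (det3 x1 x4 x2) = Num.sg (det3 x3 x2 x4)
    & Num.sg (det3 x3 x2 x4) = Num.sg (det3 x1 x3 x4)].
Proof.
(* c i is the coefficient of x i in the relation, not the i-th determinant of
   the list in the theorem. *)
pose c := tnth
  [tuple det3 x3 x2 x4; det3 x1 x3 x4; det3 x1 x4 x2; det3 x1 x2 x3].
pose x := tnth [tuple x1; x2; x3; x4].
have c_neq0 i : c i != 0.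
  apply/eqP; case: i => [[|[|[|[|//]]]] lti] /det3_eq0_coplanar;
    [ apply: contra_not h234 | apply: contra_not h134
    | apply: contra_not h124 | apply: contra_not h123 ];
    by apply: coplanar_subset => v; rewrite !inE => /or3P[]->; rewrite ?orbT.
have relation : \sum_i c i *: x i = 0.
  by rewrite !big_ord_recl big_ord0 addr0 !addrA; exact: det3_relation.
have form_relation (f : 'Hom('cV[R]_3, R^o)) : \sum_i c i * (f (x i) : R) = 0.
  by rewrite -[RHS](linear0 f) -relation linear_sum; apply: eq_bigr => i _;
     rewrite linearZ.
split=> [no_plane | [s1 s2 s3] [P [_ [f [_ f_gt0]]]]].
  have [[i [j /andP[ci_lt0 cj_gt0]]]|same_sign] := mixed_or_same_sign c_neq0.
    have [t t_gt0 ct0] := mixed_sign_positive_solution ci_lt0 cj_gt0.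
    case: no_plane.
    have [f [f1 f2 f3]] :=
      form_with_values (t 0) (t 1) (t 2) (c_neq0 3).
    have ft (k : 'I_4) : k != 3 -> f (x k) = t k.
      have: [|| k == 0, k == 1, k == 2 | k == 3].
        by case: k => [[|[|[|[]]]]].
      by case/or4P=> /eqP->.
    (* f and t satisfy the same relation, whose last coefficient is not 0. *)
    have f4 : f x4 = t 3.
      apply: (mulfI (c_neq0 3)); move: (form_relation f).
      rewrite -[RHS]ct0 (bigD1 3) // [RHS](bigD1 3) //=.
      by under eq_bigr => k k_neq3 do rewrite ft //; apply: addIr.
    exists (lker f); apply: positive_form_supporting_plane => v.
    by rewrite !inE => /or4P[]/eqP->; rewrite ?f1 ?f2 ?f3 ?f4.
  by split; [exact: (same_sign 3 2)|exact: (same_sign 2 0)|exact: (same_sign 0 1)].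
have same_sign i : Num.sg (c i) = Num.sg (c 0).
  by case: i => [[|[|[|[|//]]]] lti]; rewrite /c /tnth /= ?s1 ?s2 ?s3.
have /negP[] := @same_sign_no_positive_solution _ _ c (fun i => f (x i)) 0
  c_neq0 same_sign (fun i => f_gt0 _ (mem_tnth i _)).
by apply/eqP.
Qed.
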